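(* For any $\varepsilon > 0$ there exists a constant $d_0(\varepsilon)$ such that the following holds. Let $H$ be a $d$-regular graph with $d \ge d_0(\varepsilon)$ containing a hamiltonian cycle $\mathfrak{h}$, and let $E_f$ be a set of edges of $\mathfrak{h}$ which cover at most $(1-\varepsilon)d$ vertices of $H$. Then $H$ contains a second hamiltonian cycle (distinct from $\mathfrak{h}$) containing all edges of $E_f$. *)

(* Defs.v *)
From mathcomp Require Import all_boot all_order all_algebra.
From mathcomp Require Import reals.

Set Implicit Arguments.
Unset Strict Implicit.
Unset Printing Implicit Defensive.

(* A finite simple graph on V is given by its adjacency relation. *)
Definition simple_graph (V : finType) (e : rel V) : Prop :=
  symmetric e /\ irreflexive e.

Definition regular (V : finType) (e : rel V) (d : nat) : Prop :=
  forall x : V, #|[set y | e x y]| = d.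

Definition cycle_edges (V : finType) (c : seq V) : {set {set V}} :=
  [set [set x; next c x] | x in c].

(* A hamiltonian cycle is a subgraph, represented by its set of edges (an edge
   being the set of its two ends), so that rotating or reversing the cyclic
   sequence c does not give a different cycle. *)
Definition hamiltonian_cycle (V : finType) (e : rel V) (h : {set {set V}}) :
    Prop :=
  exists c : seq V,
    [/\ ucycle e c, 2 < size c, forall x : V, x \in c & h = cycle_edges c].

(* Main.v *)
Require Import Defs.
From mathcomp Require Import all_boot all_order all_algebra zify ring.
From mathcomp Require Import reals.
Import Order.TTheory GRing.Theory Num.Theory.
Set Implicit Arguments.
Unset Strict Implicit.
Unset Printing Implicit Defensive.

(* Suppose A is a vertex set without two consecutive vertices of the hamiltonian
   cycle c, such that every vertex x has a neighbour g x in A along an edge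
   outside c (Thomassen's red-independent, green-dominating sets).  In the
   subgraph formed by c and the edges {x, g x} with x outside A, every vertex
   outside A has degree 3 and A is independent.  Consider the hamiltonian paths
   of this subgraph that start with a fixed edge ab of c (a in A), end outside A
   and use every edge of c avoiding A.  Rotating such a path (Thomason's
   lollipops) is an involution on the class, and each path admits exactly two
   rotations, or one rotation and a closure to a cycle; hence the number of
   closable paths is even, and besides c there is another one, which still
   contains all edges of c that avoid A.

   To find A disjoint from the vertices covered by the forced edges, take
   A = {u : u in B, next u not in B} minus those vertices; this never contains
   two consecutive vertices.  Each v has at least eps d - 2 admissible neighbours;
   fix k of them, S v, no two consecutive, with k linear in d.  That v has no
   neighbour in A through S v has probability (3/4)^k for a uniform B, while
   this event shares variables with O(d^2) others.  In place of the local lemma we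
   use Rosenfeld's counting argument: the number of partial sets B that are good
   so far grows by a factor at least 9/5 with each new vertex. *)

(** * Rosenfeld's counting argument *)

Section Counting.
Variables (V I : finType) (s : V -> V) (S : I -> {set V}) (k : nat).

Definition scope (i : I) : {set V} := S i :|: s @: S i.

(* [u] with [u \in B] and [s u \notin B]: no two such vertices are consecutive for [s]. *)
Definition hit (i : I) (B : {set V}) : bool :=
  [exists u in S i, (u \in B) && (s u \notin B)].

(** Only the conditions whose whole scope lies in [T] are imposed: a subset of [T] already decides
    them. *)
Definition good (T : {set V}) : {set {set V}} :=
  [set B : {set V} | B \subset T & [forall i, (scope i \subset T) ==> hit i B]].

Hypothesis s_inj : injective s.
Hypothesis card_S : forall i, #|S i| = k.
Hypothesis S_disj : forall i, [disjoint S i & s @: S i].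

Lemma card_scope i : #|scope i| = k.*2.
Proof.
rewrite /scope cardsU disjoint_setI0 // cards0 subn0 card_imset //.
by rewrite !card_S addnn.
Qed.

Lemma hit_congr i (B B' : {set V}) :
  {in scope i, B =i B'} -> hit i B = hit i B'.
Proof.
move=> eqB; apply: eq_existsb => u; case Su: (u \in S i) => //=.
rewrite !eqB // inE ?Su //.
by rewrite imset_f ?orbT.
Qed.

(** A missed [i] forbids one of the four membership patterns on each pair [u], [s u], leaving
    [3 ^ k] traces on the scope. The trace and the rest of [B] determine [B]. *)
Lemma card_missed (i : I) (T : {set V}) (X : {set {set V}}) :
  (forall B, B \in X -> ~~ hit i B /\ B :\: scope i \in good T) ->
  #|X| <= 3 ^ k * #|good T|.
Proof.
move=> XP.
pose pat (B : {set V}) : {ffun V -> bool * bool} :=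
  [ffun u => if u \in S i then (u \in B, s u \in B) else (false, false)].
pose R := [pred q : bool * bool | q != (true, false)].
pose code (B : {set V}) := (pat B, B :\: scope i).
have injc : {in X &, injective code}.
  move=> B B' _ _ [] /ffunP eqp /setP eqo; apply/setP => y.
  case yS: (y \in scope i); last by have := eqo y; rewrite !in_setD yS.
  move: yS; rewrite inE => /orP[yS|/imsetP[u uS ->]].
    by have := eqp y; rewrite !ffunE yS => -[].
  by have := eqp u; rewrite !ffunE uS => -[].
rewrite -(card_in_imset injc).
have -> : 3 ^ k = #|[set f in pffun_on (false, false) (S i) R]|.
  rewrite cardsE card_pffun_on card_S; congr (_ ^ _).
  have : #|R| + #|predC R| = 4 by rewrite cardC card_prod card_bool.
  have -> : #|predC R| = 1.
    rewrite -(card1 (true, false)); apply: eq_card => q.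
    by rewrite !inE negbK.
  by rewrite addn1 => -[->].
rewrite -cardsX; apply: subset_leq_card; apply/subsetP => _ /imsetP[B BX ->].
have [nh gB] := XP _ BX.
rewrite in_setX gB andbT inE.
apply/pffun_onP; split.
  by apply/subsetP => u; rewrite supportE ffunE; case: ifP => //; rewrite eqxx.
move=> q /imageP[u uS ->]; rewrite ffunE uS inE.
apply: contraNN nh => /eqP[uB suB]; apply/existsP; exists u.
by rewrite uS uB suB.
Qed.

(** A scope contained in [T :\: scope i] is disjoint from [scope i], so the deletion does not affect
    whether it is hit. *)
Lemma goodD (i : I) (T B : {set V}) :
  B \in good T -> B :\: scope i \in good (T :\: scope i).
Proof.
rewrite !inE => /andP[BT /forallP gB]; rewrite setSD //=.
apply/forallP => j; apply/implyP; rewrite subsetD => /andP[jT dj].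
rewrite (hit_congr (B' := B)) ?(implyP (gB j)) //.
by move=> y yj; rewrite in_setD (disjointFr dj yj).
Qed.

Lemma card_good_extend (T : {set V}) (x : V) : x \notin T ->
  2 * #|good T| = #|[set B : {set V} | B \subset x |: T & B :\ x \in good T]|.
Proof.
move=> xT; set X := [set B | _ & _].
have subT B : B \in good T -> B \subset T by rewrite inE => /andP[].
have -> : X = good T :|: [set x |: B | B in good T].
  apply/setP => B; rewrite in_setU [B \in X]in_set.
  apply/andP/orP => [[BxT gB]|[gB|/imsetP[B0 gB ->]]].
  - have [xB|xB] := boolP (x \in B).
      by right; apply/imsetP; exists (B :\ x); rewrite ?setD1K.
    left; have -> : B = B :\ x by apply/setP=> y; rewrite !inE; case: eqP xB => // -> /negPf ->.
    exact: gB.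
  - have BT := subT _ gB.
    have xB : x \notin B by apply: contra xT; apply/subsetP.
    split; first exact: subset_trans BT (subsetU1 x T).
    by have -> : B :\ x = B by apply/setP=> y; rewrite !inE; case: eqP xB => // -> /negPf ->.
  - have BT := subT _ gB.
    have xB : x \notin B0 by apply: contra xT; apply/subsetP.
    by rewrite setUS // setU1K.
rewrite cardsU card_in_imset; last first.
  move=> B B' /subT BT /subT B'T eqB.
  have xB : x \notin B by apply: contra xT; apply/subsetP.
  have xB' : x \notin B' by apply: contra xT; apply/subsetP.
  by rewrite -(setU1K xB) eqB setU1K.
rewrite (_ : _ :&: _ = set0) ?cards0 ?subn0 ?addnn ?mul2n //.
apply/setP => B; rewrite in_setI in_set0; apply/negP => /andP[/subT BT].
case/imsetP => B0 _ eB; case/negP: xT; apply: (subsetP BT).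
by rewrite eB setU11.
Qed.

Variable D : nat.
Hypothesis k_gt0 : 0 < k.
Hypothesis card_through : forall x, #|[set i | x \in scope i]| <= D.
Hypothesis few : 9 * D * 25 ^ k <= 27 ^ k.

(* Extensions of good sets to [x |: T] that fail to be good miss some [i] whose
   scope contains [x]; each such [i] spoils at most [3 ^ k * #|good (T :\: scope i)|]
   of them, which induction bounds by [3 ^ k * (5/9) ^ (2k - 1) * #|good T|]. *)
Lemma good_growth (T : {set V}) (x : V) : x \notin T ->
  9 * #|good T| <= 5 * #|good (x |: T)|.
Proof.
have [m] := ubnP #|T|; elim: m T x => // m IH T x ltT xT.
(* The induction hypothesis, iterated while adding to [U] the [j] missing vertices of [T] one at a
   time. *)
have chain (U : {set V}) j : U \subset T -> #|T| = #|U| + j ->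
    9 ^ j * #|good U| <= 5 ^ j * #|good T|.
  elim: j U => [|j IHj] U UT cT.
    have -> : U = T by apply/eqP; rewrite eqEcard UT; lia.
    by [].
  have /properP[_ [y yT yU]] : U \proper T by rewrite properEcard UT; lia.
  have gU : 9 * #|good U| <= 5 * #|good (y |: U)| by apply: IH; lia.
  have yUT : y |: U \subset T by rewrite subUset sub1set yT.
  have := IHj _ yUT; rewrite cardsU1 yU => /(_ ltac:(lia)) hj.
  by rewrite !expnS; nia.
pose X := [set B : {set V} | B \subset x |: T & B :\ x \in good T].
pose J := [set i | x \in scope i & scope i \subset x |: T].
pose Y i := [set B in X | ~~ hit i B].
have X_cover : X \subset good (x |: T) :|: \bigcup_(i in J) Y i.
  apply/subsetP => B BX; rewrite in_setU.
  have [gB|] := boolP (B \in good (x |: T)); first by [].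
  move: (BX); rewrite !inE => /andP[-> /andP[_ /forallP gBx]] /=.
  case/forallPn => i; rewrite negb_imply => /andP[iT nh].
  apply/bigcupP; exists i; last by rewrite inE BX.
  rewrite inE iT andbT; apply: contraNT nh => xi.
  have iT' : scope i \subset T.
    apply/subsetP => y yi; move: (subsetP iT _ yi); rewrite !inE => /orP[/eqP yx|//].
    by rewrite yx (negPf xi) in yi * .
  rewrite -(hit_congr (B := B :\ x)) ?(implyP (gBx i)) // => y yi.
  by rewrite !inE; case: eqP => // yx; rewrite -yx yi in xi.
have cardY i : i \in J -> 9 ^ k.*2.-1 * #|Y i| <= 3 ^ k * 5 ^ k.*2.-1 * #|good T|.
  rewrite inE => /andP[xi iT].
  have cY : #|Y i| <= 3 ^ k * #|good (T :\: scope i)|.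
    apply: (@card_missed i) => B; rewrite [B \in _]in_set [B \in X]in_set => /andP[/andP[_ gB] nh].
    split=> //.
    have -> : B :\: scope i = (B :\ x) :\: scope i.
      by apply/setP => y; rewrite !in_setD !in_set1; case: eqP => // ->; rewrite xi.
    exact: goodD.
  have := @chain (T :\: scope i) k.*2.-1 (subsetDl _ _).
  (* The exponent is [2k - 1] because [x] is the one vertex of the scope outside [T]. *)
  have cT : #|T| = #|T :\: scope i| + k.*2.-1.
    rewrite -(cardsID (scope i) T) addnC; congr (_ + _).
    have -> : T :&: scope i = scope i :\ x.
      apply/setP => y; rewrite in_setI in_setD1; apply/andP/andP => -[].
        by move=> yT yi; split=> //; apply: contraNneq xT => <-.
      move=> yx yi; split=> //; move: (subsetP iT _ yi).
      by rewrite in_setU1 (negPf yx).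
    by have := cardsD1 x (scope i); rewrite xi card_scope; lia.
  move=> /(_ cT) hT.
  rewrite -mulnA; apply: leq_trans (leq_mul (leqnn _) hT).
  by rewrite mulnCA leq_mul2l cY orbT.
have cardX : 2 * #|good T| <= #|good (x |: T)| + \sum_(i in J) #|Y i|.
  rewrite (card_good_extend xT) (leq_trans (subset_leq_card X_cover)) //.
  apply: leq_trans (leq_card_setU _ _) _; rewrite leq_add2l.
  elim/big_rec2: _ => [|i a b _ le]; first by rewrite cards0.
  by apply: leq_trans (leq_card_setU _ _) _; rewrite leq_add2l.
have cardJ : #|J| <= D.
  apply: leq_trans (card_through x); apply: subset_leq_card.
  by apply/subsetP => i; rewrite !inE => /andP[].
have sumY : 9 ^ k.*2.-1 * \sum_(i in J) #|Y i| <=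
    D * (3 ^ k * 5 ^ k.*2.-1 * #|good T|).
  rewrite big_distrr /=; have /leq_trans-> // :
      \sum_(i in J) 9 ^ k.*2.-1 * #|Y i| <=
      \sum_(i in J) 3 ^ k * 5 ^ k.*2.-1 * #|good T|.
    exact: leq_sum.
  by rewrite sum_nat_const leq_mul2r cardJ orbT.
(* After multiplication by 9 this is [few] times [3 ^ k], as [81 = 27 * 3]. *)
have key : 5 * (D * (3 ^ k * 5 ^ k.*2.-1)) <= 9 ^ k.*2.-1.
  rewrite -(leq_pmul2l (isT : 0 < 9)) -expnS prednK ?double_gt0 //.
  rewrite mulnA (mulnC 9) -mulnA [9 * _]mulnC.
  have -> : 5 * (D * (3 ^ k * 5 ^ k.*2.-1) * 9) = 9 * D * 3 ^ k * 5 ^ (k.*2.-1).+1.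
    by rewrite expnS; ring.
  rewrite prednK ?double_gt0 // -!mul2n !expnM -[5 ^ 2]/25 -[9 ^ 2]/(27 * 3).
  by rewrite expnMn; nia.
have p9 : 0 < 9 ^ k.*2.-1 by rewrite expn_gt0.
(* By [key] at most a fifth of [#|good T|] is spoiled, and [2 - 1/5 = 9/5]. *)
rewrite -(leq_pmul2l p9); move: (leq_mul (leqnn (9 ^ k.*2.-1)) cardX).
rewrite mulnDr.
move: (leq_mul key (leqnn #|good T|)) sumY.
set a := 9 ^ _; set b := _ * 5 ^ _; set g := #|good T|; set G := #|good _|.
set sm := \sum_(i in J) _; nia.
Qed.

Lemma hitting_set_exists : exists B : {set V}, forall i, hit i B.
Proof.
suff : 0 < #|good setT|.
  case/card_gt0P => B; rewrite inE => /andP[_ /forallP gB].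
  by exists B => i; have := gB i; rewrite subsetT.
suff pos (T : {set V}) : 0 < #|good T| by rewrite pos.
have [n] := ubnP #|T|; elim: n T => // n IH T ltT.
have [->|[x xT]] := set_0Vmem T.
  (* No scope is empty, since [k > 0]; so [T = set0] imposes no condition. *)
  apply/card_gt0P; exists set0; rewrite inE subxx /=; apply/forallP => i.
  by rewrite subset0 -cards_eq0 card_scope double_eq0 (gtn_eqF k_gt0).
have := @good_growth (T :\ x) x; rewrite !inE eqxx setD1K // => /(_ isT).
have := IH (T :\ x); rewrite (cardsD1 x T) xT in ltT *; lia.
Qed.

End Counting.

(** * Sequences and their cycles *)

Lemma even_card_involution (T : finType) (D : {set T}) (f : T -> T) :
  (forall x, x \in D -> [/\ f x \in D, f (f x) = x & f x != x]) -> ~~ odd #|D|.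
Proof.
have [m] := ubnP #|D|; elim: m D => // m IH D ltD fP.
have [->|[x xD]] := set_0Vmem D; first by rewrite cards0.
have [fxD ffx fx_neq] := fP x xD.
have cD : #|D| = #|D :\ x :\ f x|.+2.
  by rewrite (cardsD1 x) xD (cardsD1 (f x) (D :\ x)) !inE fx_neq fxD.
rewrite cD /= negbK; apply: IH => [|y]; first by rewrite cD in ltD; lia.
rewrite !inE => /and3P[yfx yx /fP[fyD ffy fy_neq]]; split=> //.
rewrite fyD andbT; apply/andP; split.
  by apply: contra_neq yx => eqf; rewrite -ffy eqf ffx.
by apply: contra_neq yfx => eqf; rewrite -ffy eqf.
Qed.

Section SeqFacts.
Variable V : eqType.
Implicit Types (P Q : seq V) (x y u : V).

Lemma infix2P x y P :
  reflect (exists p q, P = p ++ x :: y :: q) (infix [:: x; y] P).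
Proof. exact: (@infixP V [:: x; y] P). Qed.

Lemma next_infix x y P : uniq P -> infix [:: x; y] P -> next P x = y.
Proof.
move=> uP /infix2P[p [q eP]].
have uP' : uniq (x :: y :: q ++ p) by rewrite -(rot_uniq (size p)) eP rot_size_cat in uP.
rewrite -(next_rot (size p) uP) eP rot_size_cat /=.
by rewrite eqxx.
Qed.

Lemma prev_infix x y P : uniq P -> infix [:: x; y] P -> prev P y = x.
Proof. by move=> uP /(next_infix uP) <-; rewrite prev_next. Qed.

Lemma infix_last x y P z : uniq P -> infix [:: x; y] P -> last z P <> x.
Proof.
move=> uP /infix2P[p [q eP]]; move: uP; rewrite eP last_cat /= cat_uniq.
case/and3P=> _ _ /= /andP[xq _] lx.
by case/negP: xq; rewrite -{1}lx mem_last.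
Qed.

Lemma infix2_split x y u P Q : x != u -> y != u ->
  infix [:: x; y] (P ++ u :: Q) = infix [:: x; y] P || infix [:: x; y] Q.
Proof.
move=> xu yu; elim: P => [|z P IH] /=; first by rewrite (negPf xu).
rewrite IH orbA; congr (_ || _ || _); case: P {IH} => [|t P] /=; last by rewrite !prefix0s.
  by rewrite (negPf yu) andbF.
Qed.

Lemma infix2_rev x y P : infix [:: x; y] (rev P) = infix [:: y; x] P.
Proof. by rewrite -(infix_rev [:: y; x]). Qed.

Definition consec P x y := infix [:: x; y] P || infix [:: y; x] P.

Lemma consec_rev P x y : consec (rev P) x y = consec P x y.
Proof. by rewrite /consec !infix2_rev orbC. Qed.

(** With [u] the pivot of a rotation, this shows that reversing [Q] preserves every adjacency
    avoiding [u]. *)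
Lemma consec_split x y u P Q : x != u -> y != u ->
  consec (P ++ u :: Q) x y = consec P x y || consec Q x y.
Proof.
by move=> xu yu; rewrite /consec !infix2_split // orbACA.
Qed.

(** Path rotation: for [u] on [P], the edge from [u] to its successor is exchanged for one from [u]
    to the end of [P]. *)
Definition rot_at u P :=
  take (index u P).+1 P ++ rev (drop (index u P).+1 P).

Lemma rot_at_cat u P Q : u \notin P -> rot_at u (P ++ u :: Q) = P ++ u :: rev Q.
Proof.
move=> uP; rewrite /rot_at index_cat (negPf uP) /= eqxx addn0.
rewrite -cat_rcons -(size_rcons P u) take_size_cat // drop_size_cat //.
by rewrite cat_rcons.
Qed.

Lemma size_rot_at u P : size (rot_at u P) = size P.
Proof. by rewrite size_cat size_rev -size_cat cat_take_drop. Qed.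

End SeqFacts.

Section NextFacts.
Variables (V : finType) (c : seq V).
Hypotheses (uc : uniq c) (c_gt2 : 2 < size c) (c_all : forall x, x \in c).

Lemma next_neq x : next c x != x.
Proof.
apply/eqP => nx.
have := order_le_cycle (f := next c) (p := [:: x]) _ (mem_head _ _).
rewrite /= nx eqxx => /(_ isT).
by rewrite (order_cycle (cycle_next uc) uc) //; lia.
Qed.

Lemma next_next_neq x : next c (next c x) != x.
Proof.
apply/eqP => nx.
have := order_le_cycle (f := next c) (p := [:: x; next c x]) _ (mem_head _ _).
rewrite /= nx !eqxx => /(_ isT).
by rewrite (order_cycle (cycle_next uc) uc) //; lia.
Qed.

Lemma next_neq_prev x : next c x != prev c x.
Proof.
by apply: contra_neq (next_next_neq x) => ->; rewrite next_prev.
Qed.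

Lemma mem_cycle_edges x y :
  ([set x; y] \in cycle_edges c) = (y == next c x) || (x == next c y).
Proof.
apply/imsetP/orP => [[z _ /setP ez]|[/eqP->|/eqP->]]; first 1 last.
- by exists x.
- by exists y; rewrite // setUC.
have nz := next_neq z.
have /esym := ez x; rewrite !inE eqxx => /orP[]/eqP ex;
  have /esym := ez y; rewrite !inE eqxx orbT => /orP[]/eqP ey;
  rewrite ex ey ?eqxx; [| by left | by right |].
- by have := ez (next c z); rewrite !inE ex ey !eqxx orbT orbb (negPf nz).
- by have := ez z; rewrite !inE ex ey !eqxx orbb eq_sym (negPf nz).
Qed.

End NextFacts.

(* Knowing [prev] at a vertex, the edge set determines [next] there; so the edge
   set and the first two vertices determine the cyclic sequence. *)
Lemma cycle_edges_inj (V : finType) (a b : V) (q q' : seq V) :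
    let c := a :: b :: q in let c' := a :: b :: q' in
    uniq c -> uniq c' -> 2 < size c -> 2 < size c' ->
    (forall x, x \in c) -> (forall x, x \in c') ->
  cycle_edges c = cycle_edges c' -> c = c'.
Proof.
move=> c c' uc uc' c2 c2' c_all c_all' eqE.
have fc : c = a :: traject (next c) (next c a) (size (b :: q)).
  congr (_ :: _); apply: fpathE; have := cycle_next uc.
  by rewrite /c /= rcons_path => /and3P[/= -> -> _].
have fc' : c' = a :: traject (next c') (next c' a) (size (b :: q')).
  congr (_ :: _); apply: fpathE; have := cycle_next uc'.
  by rewrite /c' /= rcons_path => /and3P[/= -> -> _].
have nextE i : next c' (iter i (next c) a) = next c (iter i (next c) a).
  elim: i => [|i IH]; first by rewrite /= !eqxx.
  rewrite iterS; set y := iter i _ _ in IH *.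
  have := mem_cycle_edges uc' c2' c_all' (next c y) (next c' (next c y)).
  rewrite eqxx orTb -eqE mem_cycle_edges // => /orP[/eqP //|/eqP].
  (* In the other case [next c'] sends [next c y] back to [y], so by [IH] two steps along [c'] would
     return to [y]. *)
  move/(can_inj (prev_next uc)) => ey.
  by move: ey (next_next_neq uc' c2' c_all' y); rewrite IH => <-; rewrite eqxx.
have eqn : next c' =1 next c.
  move=> x; have : x \in c by [].
  rewrite {1}fc -trajectS => /trajectP[j _ ->]; exact: nextE.
have eqs : size q = size q'.
  have : size c = size c' by rewrite -!(card_uniqP _) //; apply: eq_card => x; rewrite c_all c_all'.
  by move=> /= -[].
have : fpath (next c) a (b :: q').
  rewrite -(eq_fpath eqn); have := cycle_next uc'.
  by rewrite /c' /= rcons_path => /and3P[/= -> -> _].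
by move=> /fpathE e; rewrite fc /c' e; rewrite [size (b :: q)]/= eqs.
Qed.

(** * Lollipops *)

Section Lollipop.
Variables (V : finType) (c : seq V) (A : {set V}) (g : V -> V) (a b : V).
Hypotheses (uc : uniq c) (c_gt2 : 2 < size c) (c_all : forall x, x \in c).
Hypothesis c_ab : prefix [:: a; b] c.
Hypothesis aA : a \in A.
Hypothesis A_indep : forall x, x \in A -> next c x \notin A.
Hypothesis gA : forall x, g x \in A.
Hypothesis g_next : forall x, g x != next c x.
Hypothesis g_prev : forall x, g x != prev c x.

Definition nbrs x := [:: next c x; prev c x; g x].

Definition adj : rel V :=
  fun x y => (x \notin A) && (y \in nbrs x) || (y \notin A) && (x \in nbrs y).

Lemma adj_sym : symmetric adj.
Proof. by move=> x y; rewrite /adj orbC. Qed.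

(** Cycle edges are listed at both ends, and [g] takes values in [A], so a vertex outside [A] gains
    no neighbour from the other clause. *)
Lemma adj_nb x y : x \notin A -> adj x y = (y \in nbrs x).
Proof.
move=> xA; rewrite /adj xA /=; have [//|ynx /=] := boolP (y \in nbrs x).
apply: contraNF ynx => /andP[yA]; rewrite !inE.
case/or3P=> /eqP ex; rewrite ex.
- by rewrite prev_next // eqxx orbT.
- by rewrite next_prev // eqxx.
- by rewrite ex gA in xA.
Qed.

(* The last clause says that [P] runs along every cycle edge avoiding [A]. *)
Definition spath P := [&& uniq P, size P == size c, prefix [:: a; b] P,
  sorted adj P, last a P \notin A &
  [forall x, (x \notin A) ==> (next c x \notin A) ==> consec P x (next c x)]].

(* [u] is a neighbour of the end of [P] other than its predecessor on [P]; the case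
   [u = a] corresponds to closing [P] into a cycle, all others to a rotation. *)
Definition turn P u := (u \in nbrs (last a P)) && ~~ infix [:: u; last a P] P.

Lemma spath_all P x : spath P -> x \in P.
Proof.
case/and3P=> uP /eqP sP _.
have cV : #|V| = size c.
  by rewrite -(card_uniqP uc); apply: eq_card => y; rewrite c_all.
have /subset_cardP : #|P| = #|V| by rewrite (card_uniqP uP) sP.
by move/(_ (subset_predT _))->.
Qed.

(* A turn outside [A] would give a cycle edge avoiding [A] that [P] does not use. *)
Lemma turn_A P u : spath P -> turn P u -> u \in A.
Proof.
case/and5P=> uP _ _ _ /andP[wA /forallP kept]; rewrite /turn; set w := last a P in wA *.
case/andP => unb ninf; apply: contraNT ninf => uA.
have wlast y : infix [:: w; y] P = false.
  by apply/negP => /(infix_last (z := a) uP); apply.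
move: unb; rewrite !inE => /or3P[]/eqP eu.
- by have := kept w; rewrite wA -eu uA /consec wlast.
- have := kept u; rewrite uA eu next_prev // wA /consec wlast orbF.
  by [].
- by rewrite eu gA in uA.
Qed.

Lemma prefix_rot P Q u : u != a ->
  prefix [:: a; b] (P ++ u :: rev Q) = prefix [:: a; b] (P ++ u :: Q).
Proof.
rewrite eq_sym => au; case: P => [|x [|y P]] /=; rewrite ?(negPf au) //.
all: by rewrite ?prefix0s ?andbF.
Qed.

Lemma path_rev_sym (e : rel V) u Q : symmetric e ->
  path e u Q -> e u (last u Q) -> path e u (rev Q).
Proof.
move=> e_sym; case/lastP: Q => // Q w pQ; rewrite last_rcons rev_rcons /= => ->.
have := rev_path e u (rcons Q w); rewrite last_rcons belast_rcons rev_cons rcons_path.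
rewrite (eq_path (e' := e)); last by move=> x y; rewrite e_sym.
by rewrite pQ => /andP[].
Qed.

(** The pivot [u] is in [A], so the new end, adjacent to it, is outside [A]. The exchanged edges
    both meet [u], so edges avoiding [A] survive; a second reversal restores [P]. *)
Lemma rot_step P u : spath P -> turn P u -> u != a ->
  [/\ spath (rot_at u P), turn (rot_at u P) u, rot_at u (rot_at u P) = P
    & rot_at u P != P].
Proof.
move=> sP tP ua; have uA := turn_A sP tP.
have uinP := spath_all u sP.
case/splitPr: uinP sP tP => P1 Q sP /andP[unb ninf].
case/and5P: sP => uP szP prP soP /andP[wA /forallP kept].
have uP1 : u \notin P1.
  by move: uP; rewrite cat_uniq /= negb_or => /and3P[_ /andP[]].
rewrite rot_at_cat // rot_at_cat // revK.
rewrite last_cat /= in unb ninf wA.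
have uw : adj u (last u Q) by rewrite adj_sym adj_nb.
have soP' : sorted adj (P1 ++ u :: rev Q).
  move: soP; case: (P1) => [|x P2] /=.
    by move=> pQ; apply: path_rev_sym => //; exact: adj_sym.
  rewrite !cat_path /= => /and3P[-> -> pQ] /=.
  by apply: path_rev_sym => //; exact: adj_sym.
have uP' : uniq (P1 ++ u :: rev Q).
  by rewrite -(perm_uniq (s1 := P1 ++ u :: Q)) // perm_cat2l perm_cons perm_sym perm_rev.
(* At least two vertices follow the pivot: the end is outside [A], hence is not [u], and [turn]
   excludes its predecessor. *)
case: Q => [|y Q] in uP szP prP soP unb ninf wA kept uw soP' uP' *.
  by rewrite /= uA in wA.
case/lastP: Q => [|Q w] in uP szP prP soP unb ninf wA kept uw soP' uP' *.
  by case/negP: ninf; apply/infix2P; exists P1, [::].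
rewrite /= last_rcons in unb ninf wA uw.
set Q1 := y :: rcons Q w in uP szP prP soP kept soP' uP' *.
have lQ : last u (rev Q1) = y by rewrite /Q1 rev_cons last_rcons.
have yw : y != w.
  move: uP; rewrite /Q1 cat_uniq /= mem_rcons inE.
  by case: eqVneq => //=; rewrite /= !andbF.
have adjuy : adj u y.
  move: soP; case: (P1) => [|x P2] /=; first by case/andP.
  by rewrite cat_path /= => /and4P[].
have yA : y \notin A.
  by apply: contraL adjuy => yA; rewrite /adj uA yA.
have infuw : infix [:: u; w] (P1 ++ u :: rev Q1).
  by apply/infix2P; exists P1, (rcons (rev Q) y); rewrite /Q1 rev_cons rev_rcons.
split=> //.
- rewrite /spath uP' -(eqP szP) !size_cat /= size_rev eqxx prefix_rot // prP soP' /=.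
  rewrite last_cat /= lQ yA /=; apply/forallP => x; apply/implyP => xA.
  apply/implyP => nxA.
  have xu : x != u by apply: contraNneq xA => ->.
  have nxu : next c x != u by apply: contraNneq nxA => ->.
  have := kept x; rewrite xA nxA /= !consec_split //.
  by rewrite consec_rev.
- rewrite /turn last_cat /= lQ -adj_nb // adj_sym adjuy /=.
  apply: contra yw => /(next_infix uP') <-.
  by rewrite (next_infix uP' infuw).
- apply: contra_neq yw => /(congr1 (last a)).
  by rewrite !last_cat /= lQ /Q1 /= last_rcons.
Qed.

Lemma uniq_nb x : uniq (nbrs x).
Proof.
rewrite /= !inE negb_or andbT next_neq_prev //= eq_sym g_next /=.
by rewrite eq_sym g_prev.
Qed.

Lemma card_turn P : spath P -> #|[set u | turn P u]| = 2.
Proof.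
case/and5P=> uP szP _ soP /andP[wA _].
have [P0 [u0 [w eP]]] : exists P0 u0 w, P = rcons (rcons P0 u0) w.
  have : 2 < size P by rewrite (eqP szP).
  case/lastP: P {uP szP soP wA} => [|P w] //.
  case/lastP: P => [|P u0] //; by exists P, u0, w.
have lw : last a P = w by rewrite eP last_rcons.
have infE u : infix [:: u; w] P = (u == u0).
  have inf0 : infix [:: u0; w] P.
    by apply/infix2P; exists P0, [::]; rewrite eP -!cats1 -catA.
  apply/idP/eqP => [infu|-> //].
  by rewrite -(prev_infix uP infu) (prev_infix uP inf0).
have u0nb : u0 \in nbrs w.
  rewrite -adj_nb -?lw // adj_sym lw; move: soP; rewrite eP.
  case: (P0) => [|z P1] /=; rewrite ?andbT //.
  by rewrite !rcons_path last_rcons => /andP[].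
have -> : [set u | turn P u] = [set u in nbrs w] :\ u0.
  by apply/setP => u; rewrite !inE /turn lw infE andbC !inE.
apply/eqP; rewrite -eqSS; apply/eqP.
have := cardsD1 u0 [set u in nbrs w]; rewrite inE u0nb add1n => <-.
by rewrite cardsE (card_uniqP (uniq_nb w)).
Qed.

(** The successor of [a] on [P] is [b], which is not the end because [P] has more than two
    vertices. *)
Lemma turn_start P : spath P -> turn P a = (a \in nbrs (last a P)).
Proof.
case/and3P=> uP szP /andP[/prefixP[Q eP] _]; rewrite /turn.
have [_ /=|//] := boolP (a \in _).
apply/negP => /(next_infix uP); rewrite eP /= eqxx.
have : 2 < size P by rewrite (eqP szP).
move: uP; rewrite eP; case/lastP: Q {eP} => // Q w uP _.
rewrite /= last_rcons => bw; move: uP; rewrite -bw /=.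
by rewrite mem_rcons inE eqxx /= andbF.
Qed.

Lemma spath_c : spath c /\ a \in nbrs (last a c).
Proof.
case/prefixP: (c_ab) => q eq.
have cyc := cycle_next uc.
have lastE : next c (last a c) = a.
  have -> : last a c = last b q by rewrite eq.
  by move: cyc; rewrite {2}eq /= rcons_path => /and3P[_ _ /eqP].
have lA : last a c \notin A.
  by apply: contraL aA => /A_indep; rewrite lastE.
split; last by rewrite inE lastE eqxx.
rewrite /spath uc eqxx c_ab lA /=; apply/andP; split.
  have : fpath (next c) a (b :: q).
    by move: cyc; rewrite {2}eq /= rcons_path => /and3P[-> -> _].
  rewrite {2}eq; apply: sub_path => x _ /eqP <-; rewrite /adj !inE eqxx /=.
  rewrite andbT prev_next // eqxx orbT andbT.
  by have [/A_indep|] := boolP (x \in A).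
apply/forallP => x; apply/implyP => xA; apply/implyP => nxA; apply/orP; left.
have xl : x != last a c by apply: contraNneq nxA => ->; rewrite lastE.
have [p [q' ec]] : exists p q', c = p ++ x :: q' by case/splitPr: (c_all x) => p q'; exists p, q'.
case: q' ec => [|y q'] ec.
  by rewrite ec last_cat /= eqxx in xl.
have inf : infix [:: x; y] c by apply/infix2P; exists p, q'.
by rewrite (next_infix uc inf).
Qed.

Definition rot_tuple n u (P : n.-tuple V) : n.-tuple V :=
  Tuple (introT eqP (etrans (size_rot_at u P) (size_tuple P))).

Lemma second_spath : exists P, [/\ spath P, a \in nbrs (last a P) & P != c].
Proof.
pose n := size c.
(* Each path has two turns, so [D] is even. Rotation pairs off the turns other than [a], so the
   closable paths [Da] are even in number, and [c] is one of them. *)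
pose D := [set x : n.-tuple V * V | spath x.1 && turn x.1 x.2].
pose Da := [set x in D | x.2 == a].
have evenD : ~~ odd #|D|.
  have -> : #|D| = #|[set P : n.-tuple V | spath P]| * 2.
    rewrite -sum1_card.
    rewrite (eq_bigl (fun x : n.-tuple V * V => spath x.1 && turn x.1 x.2));
      last by move=> x; rewrite inE.
    rewrite -(pair_big_dep (fun P : n.-tuple V => spath P) (fun P u => turn P u) (fun _ _ => 1)) /=.
    rewrite -sum_nat_const; apply: eq_big => [P|P sP]; first by rewrite inE.
    by rewrite sum1dep_card card_turn.
  by rewrite muln2 odd_double.
have evenDD : ~~ odd #|D :\: Da|.
  apply: (even_card_involution (f := fun x => (rot_tuple x.2 x.1, x.2))).
  case=> P u; rewrite !inE /= => /andP[ua /andP[sP tP]].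
  have {}ua : u != a by move: ua; rewrite sP tP.
  have [sP' tP' rr neq] := rot_step sP tP ua.
  rewrite sP' tP' ua; split=> //; first by congr (_, _); apply: val_inj.
  by rewrite xpair_eqE negb_and -val_eqE neq.
have evenDa : ~~ odd #|Da|.
  have := cardsID Da D; rewrite (setIidPr _); last by apply/subsetP => x; rewrite inE => /andP[].
  by move=> /(congr1 odd); rewrite oddD (negPf evenD) (negPf evenDD) addbF => ->.
have [sc ac] := spath_c.
pose x0 : n.-tuple V * V := (in_tuple c, a).
have x0D : x0 \in Da by rewrite !inE /= sc turn_start // ac eqxx.
have : 0 < #|Da :\ x0|.
  by move: evenDa; rewrite (cardsD1 x0) x0D; case: #|_|.
case/card_gt0P => -[P u]; rewrite !inE /= => /andP[neq /andP[/andP[sP tP] /eqP ua]].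
exists P; rewrite sP -turn_start // -{1}ua; split=> //.
by apply: contra_neq neq => eP; rewrite ua; congr (_, _); apply: val_inj.
Qed.

End Lollipop.

(** * Forced edges in regular graphs *)

(** The new path is closed by the edge from its end to [a]. Both cyclic sequences begin with [a],
    [b], so being distinct they have distinct edge sets. *)
Lemma second_cycle_from (V : finType) (e : rel V) (c : seq V) (A : {set V})
    (g : V -> V) (a b : V) :
    symmetric e -> ucycle e c -> 2 < size c -> (forall x, x \in c) ->
    prefix [:: a; b] c -> a \in A ->
    (forall x, x \in A -> next c x \notin A) ->
    (forall x, [/\ g x \in A, e x (g x), g x != next c x & g x != prev c x]) ->
  exists c', [/\ ucycle e c', 2 < size c', forall x, x \in c',
    cycle_edges c' <> cycle_edges c &
    forall x, x \notin A -> next c x \notin A ->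
      [set x; next c x] \in cycle_edges c'].
Proof.
move=> e_sym /andP[cyc uc] c_gt2 c_all c_ab aA A_indep gP.
have gA x : g x \in A by case: (gP x).
have g_next x : g x != next c x by case: (gP x).
have g_prev x : g x != prev c x by case: (gP x).
have [P [sP aP Pc]] := second_spath uc c_gt2 c_all c_ab aA A_indep gA g_next g_prev.
have P_all x := spath_all uc c_all x sP.
case/and5P: sP => uP /eqP szP prP soP /andP[wA /forallP kept].
have nb_e x y : y \in nbrs c g x -> e x y.
  rewrite !inE => /or3P[]/eqP->; last by case: (gP x).
  - exact: next_cycle.
  - by rewrite e_sym; exact: prev_cycle.
have adj_e : subrel (adj c A g) e.
  by move=> x y /orP[]/andP[_ /nb_e //]; rewrite e_sym.
have P_gt2 : 2 < size P by rewrite szP.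
case/prefixP: prP => q' /= eP; case/prefixP: c_ab => q /= eq.
exists P; split=> //.
- rewrite /ucycle uP andbT; move: soP aP; rewrite eP /= rcons_path.
  by case/andP=> /adj_e -> /(sub_path adj_e) -> /nb_e ->.
- move=> eqE; case/eqP: Pc; move: eqE.
  rewrite eP eq; apply: cycle_edges_inj; rewrite -?eP -?eq //.
- move=> x xA nxA; rewrite mem_cycle_edges //.
  have := kept x; rewrite xA nxA => /orP[] /(next_infix uP) ->; rewrite eqxx ?orbT //.
Qed.

(** Rotating [c] to start in [A] changes neither [next] nor the edge set. *)
Lemma second_cycle (V : finType) (e : rel V) (c : seq V) (A : {set V})
    (g : V -> V) :
    symmetric e -> ucycle e c -> 2 < size c -> (forall x, x \in c) ->
    (forall x, x \in A -> next c x \notin A) ->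
    (forall x, [/\ g x \in A, e x (g x), g x != next c x & g x != prev c x]) ->
  exists c', [/\ ucycle e c', 2 < size c', forall x, x \in c',
    cycle_edges c' <> cycle_edges c &
    forall x, x \notin A -> next c x \notin A ->
      [set x; next c x] \in cycle_edges c'].
Proof.
move=> e_sym cyc c_gt2 c_all A_indep gP.
have [x0 _] : exists x, x \in c.
  case: c c_gt2 {cyc c_all A_indep gP} => // x c _.
  by exists x; rewrite mem_head.
have aA : g x0 \in A by case: (gP x0).
have uc : uniq c by case/andP: cyc.
have [i c1 rotE] := rot_to (c_all (g x0)).
have nextE := next_rot i uc.
have edgesE : cycle_edges (rot i c) = cycle_edges c.
  apply/setP => E; apply/imsetP/imsetP => -[x _ ->]; exists x; rewrite ?mem_rot ?nextE //.
have [b] : exists b, prefix [:: g x0; b] (rot i c).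
  have : 2 < size (rot i c) by rewrite size_rot.
  rewrite rotE; case: (c1) => [|b c2] // _.
  by exists b; rewrite /= !eqxx prefix0s.
move=> pre.
have [] := @second_cycle_from V e (rot i c) A g (g x0) b e_sym _ _ _ pre aA.
- by rewrite rot_ucycle.
- by rewrite size_rot.
- by move=> x; rewrite mem_rot.
- by move=> x; rewrite nextE; exact: A_indep.
- by move=> x; rewrite nextE prev_rot //; exact: gP.
move=> c' [H1 H2 H3]; rewrite edgesE => H4 H5; exists c'; split=> // x.
by rewrite -nextE; exact: H5.
Qed.

(* Inductive from k = 26 on, where (k + 1) / (k - 1) <= 27 / 25; 650 = 26 * 25. *)
Lemma exponential_beats_quadratic k : k * k.-1 * 25 ^ k <= 650 * 27 ^ k.
Proof.
elim: k => // k IH; rewrite !expnS /= mulnCA [650 * _]mulnCA.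
have [k_small|k_big] := leqP k 25.
  apply: leq_mul => //; apply: leq_mul.
    by apply: (@leq_trans (26 * 25)) => //; exact: leq_mul.
  by case: (k) => // j; rewrite leq_exp2r.
have step : 25 * (k.+1 * k) <= 27 * (k * k.-1) by nia.
by rewrite mulnA (leq_trans (leq_mul step (leqnn _))) // -mulnA leq_mul2l.
Qed.

(** Greedy choice: each chosen [u] rules out only [u], [s u] and [p u], whence the factor 3. *)
Lemma spread_subset (V : finType) (s p : V -> V) (N : {set V}) k :
    cancel s p -> (forall x, s x != x) -> 3 * k <= #|N| ->
  exists S : {set V}, [/\ S \subset N, #|S| = k & [disjoint S & s @: S]].
Proof.
move=> sK s_neq; elim: k N => [|k IH] N leN.
  by exists set0; rewrite sub0set cards0 -setI_eq0 set0I.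
have [u uN] : exists u, u \in N by apply/card_gt0P; lia.
pose N' := N :\ u :\ s u :\ p u.
have [|S [SN cS dS]] := IH N'.
  have := cardsD1 u N; have := cardsD1 (s u) (N :\ u).
  by have := cardsD1 (p u) (N :\ u :\ s u); rewrite /N'; lia.
have SP x : x \in S -> [/\ x != p u, x != s u, x != u & x \in N].
  by move/(subsetP SN); rewrite !inE => /and4P.
exists (u |: S); split.
- by rewrite subUset sub1set uN; apply/subsetP => x /SP[].
- rewrite cardsU1 cS; case: (boolP (u \in S)) => // /SP[_ _].
  by rewrite eqxx.
- rewrite -setI_eq0; apply/set0Pn => -[x]; rewrite in_setI => /andP[xS /imsetP[y yS exy]].
  move: xS yS; rewrite !in_setU1 => /orP[/eqP xu|xS] /orP[/eqP yu|yS].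
  + by have := s_neq u; rewrite -{1}yu -exy xu eqxx.
  + by have [] := SP y yS; rewrite -xu exy sK eqxx.
  + by have [_] := SP x xS; rewrite exy yu eqxx.
  + by have := disjointFr dS xS; rewrite exy imset_f.
Qed.

Lemma regular_second_cycle (V : finType) (e : rel V) (d k : nat) (c : seq V)
    (F : {set V}) :
    symmetric e -> regular e d -> ucycle e c -> 2 < size c ->
    (forall x, x \in c) -> 0 < k -> 3 * k + 2 + #|F| <= d ->
    18 * d * 25 ^ k <= 27 ^ k ->
  exists c', [/\ ucycle e c', 2 < size c', forall x, x \in c',
    cycle_edges c' <> cycle_edges c &
    forall x, x \in F -> next c x \in F ->
      [set x; next c x] \in cycle_edges c'].
Proof.
move=> e_sym reg cyc c_gt2 c_all k_gt0 kd few.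
have uc : uniq c by case/andP: cyc.
pose s := next c; pose p := prev c.
have sK : cancel s p by exact: prev_next.
have pK : cancel p s by exact: next_prev.
pose N v := [set y | e v y] :\: F :\ s v :\ p v.
have cardN v : 3 * k <= #|N v|.
  have := cardsD1 (p v) ([set y | e v y] :\: F :\ s v).
  have := cardsD1 (s v) ([set y | e v y] :\: F).
  have := cardsID F [set y | e v y]; rewrite reg.
  have := subset_leq_card (subsetIr [set y | e v y] F).
  by rewrite /N; lia.
have S_ex v : exists S : {set V}, [&& S \subset N v, #|S| == k & [disjoint S & s @: S]].
  have [S [SN /eqP cS dS]] := spread_subset sK (next_neq uc c_gt2 c_all) (cardN v).
  by exists S; rewrite SN cS dS.
pose S v := xchoose (S_ex v).
have SP v := and3P (xchooseP (S_ex v)).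
have SN v y : y \in S v -> [/\ y != p v, y != s v, y \notin F & e v y].
  by case: (SP v) => /subsetP sub _ _ /sub; rewrite !inE => /and4P.
have [||x||B BP] := @hitting_set_exists V V s S k (can_inj sK) _ _ (2 * d) k_gt0.
- by move=> v; case: (SP v) => _ /eqP.
- by move=> v; case: (SP v).
(* If [x] is in the scope of [v], then [v] is adjacent to [x] or to [p x]; hence the bound
   [2 * d]. *)
- have : [set v | x \in scope s S v] \subset [set v | e x v] :|: [set v | e (p x) v].
    apply/subsetP => v; rewrite !inE => /orP[/SN[_ _ _ exv]|/imsetP[y /SN[_ _ _ evy] ->]].
      by rewrite e_sym exv.
    by rewrite sK [e y v]e_sym evy orbT.
  move/subset_leq_card/leq_trans; apply.
  by apply: leq_trans (leq_card_setU _ _) _; rewrite !reg mul2n addnn.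
- by rewrite mulnA.
pose A := [set u in B | (s u \notin B) && (u \notin F)].
have g_ex v : exists u, [&& u \in A, e v u, u != s v & u != p v].
  have /existsP[u /and3P[/SN[up us uF evu] uB suB]] := BP v.
  by exists u; rewrite inE uB suB uF evu us up.
pose g v := xchoose (g_ex v).
have [||c' [H1 H2 H3 H4 H5]] := @second_cycle V e c A g e_sym cyc c_gt2 c_all.
- move=> x; rewrite !inE => /and3P[_ sxB _].
  by rewrite -/(s x) (negPf sxB).
- by move=> v; apply/and4P; exact: (xchooseP (g_ex v)).
exists c'; split=> // x xF nxF; apply: H5.
  by rewrite inE xF !andbF.
by rewrite inE nxF !andbF.
Qed.

Local Open Scope ring_scope.

(* cover Ef is the set of vertices incident with an edge of Ef. *)
Theorem theorem6 (R : realType) (eps : R) (heps : 0 < eps) :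
  exists d0 : nat,
    forall (V : finType) (e : rel V) (d : nat) (h Ef : {set {set V}}),
      simple_graph e -> regular e d -> (d0 <= d)%N ->
      hamiltonian_cycle e h ->
      Ef \subset h ->
      (#|cover Ef|)%:R <= (1 - eps) * d%:R ->
      exists h' : {set {set V}},
        [/\ hamiltonian_cycle e h', h' <> h & Ef \subset h'].
Proof.
pose m := Num.bound eps^-1.
have m_eps : 1 < eps * m%:R.
  rewrite mulrC -ltr_pdivrMr // div1r.
  by apply: archi_boundP; rewrite invr_ge0 ltW.
have m_gt0 : (0 < m)%N by case: m m_eps => //; rewrite mulr0 ltr10.
(* The integer [m] exceeds [1 / eps], so more than [d / m >= 5k] vertices are uncovered for
   [k = d %/ (5 * m)]; [5k] leaves room for the required [3k + 2]. *)
exists (5 * m * (650 * 18 * 5 * m + 2))%N => V e d h Ef [e_sym _] reg d_big.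
move=> [c [cyc c_gt2 c_all ->]] Efh cov.
have covN : (m * #|cover Ef| + d <= m * d)%N.
  rewrite -(ler_nat R) natrD !natrM.
  apply: (@le_trans _ _ (m%:R * ((1 - eps) * d%:R) + eps * m%:R * d%:R)).
    apply: lerD; first by rewrite ler_wpM2l.
    by rewrite ler_peMl // ltW.
  by rewrite le_eqVlt; apply/orP; left; apply/eqP; ring.
pose k := (d %/ (5 * m))%N.
have k_big : (650 * 18 * 5 * m + 2 <= k)%N by rewrite leq_divRL ?muln_gt0 // mulnC.
have d_ge : (k * (5 * m) <= d)%N by exact: leq_trunc_div.
have d_lt : (d < k.+1 * (5 * m))%N by rewrite -ltn_divLR ?muln_gt0.
have [|||c' [cyc' c'_gt2 c'_all neq keep]] :=
    @regular_second_cycle V e d k c (cover Ef) e_sym reg cyc c_gt2 c_all.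
- by lia.
- have : (m * (5 * k + #|cover Ef|) <= m * d)%N.
    by apply: leq_trans covN; rewrite mulnDr addnC leq_add2l mulnA (mulnC m) mulnC.
  by rewrite leq_pmul2l //; lia.
- rewrite -(leq_pmul2l (isT : (0 < 650)%N)).
  apply: leq_trans (exponential_beats_quadratic k).
  rewrite mulnA leq_mul2r; apply/orP; right.
  (* It remains to see [650 * 18 * d <= k * (k - 1)]. With [k = j + 2] and [d < (j + 3) * 5 * m],
     the left side is at most [j * (j + 3)], below [(j + 2) * (j + 1)]. *)
  case: (k) k_big d_lt => [|[|j]] k_big d_lt; [by lia | by lia |].
  have Cj : (650 * 18 * 5 * m <= j)%N by lia.
  have := leq_mul Cj (leqnn j.+3).
  by move: d_lt; rewrite /=; lia.
exists (cycle_edges c'); split=> //; first by exists c'.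
apply/subsetP => E EEf.
have /imsetP[x _ eE] := subsetP Efh _ EEf.
have cov_mem y : y \in E -> y \in cover Ef by move=> yE; apply/bigcupP; exists E.
rewrite eE; apply: keep; apply: cov_mem; rewrite eE !inE eqxx ?orbT //.
Qed.
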